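(* Let $W\in\mathbb{R}^{n\times n}$ be symmetric positive definite, let $T\in\mathbb{R}^{n\times n}$ be symmetric, indefinite and nonsingular, and let $A=W+\mathrm{i}T$. Let $\xi_{\max}$ be an eigenvalue of $T^{-1}W$ of largest absolute value. For $\alpha>0$ let $$G(W;\alpha)=\frac{1}{\alpha+1}\left(\mathrm{i}\alpha T^{-1}W+I\right).$$ Then the spectral radius is $$\rho(G(W;\alpha))=\frac{1}{\alpha+1}\sqrt{\alpha^{2}\xi_{\max}^{2}+1}.$$ In addition: (i) If $|\xi_{\max}|\le 1$, then $\rho(G(W;\alpha))<1$ for every $\alpha>0$, and the iteration $$Tx^{(k+1)}=\frac{1}{\alpha+1}(\mathrm{i}\alpha W+T)x^{(k)}-\frac{\alpha\,\mathrm{i}}{\alpha+1}b,\qquad k=0,1,2,\dots,$$ is convergent for every $\alpha>0$. (ii) If $|\xi_{\max}|>1$, then $\rho(G(W;\alpha))<1$ provided $\alpha\in\left(0,\dfrac{2}{\xi_{\max}^{2}-1}\right)$.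
   Context: A real symmetric matrix is indefinite if it has at least one positive and at least one negative eigenvalue. The eigenvalues of $T^{-1}W$ are real, since $T^{-1}W$ is similar to the symmetric matrix $W^{1/2}T^{-1}W^{1/2}$. The displayed iteration is the PLHSS iteration $(\alpha V+W)x^{(k+1/2)}=(\alpha V-\mathrm{i}T)x^{(k)}+b$, $Tx^{(k+1)}=\mathrm{i}Wx^{(k+1/2)}-\mathrm{i}b$ for $Ax=b$ with the choice $V=W$, and $G(W;\alpha)$ is its iteration matrix. It is called convergent if for all $b,x^{(0)}\in\mathbb{C}^n$ the sequence $x^{(k)}$ converges to the unique solution of $Ax=b$. *)

(* Defs.v *)
From HB Require Import structures.
From mathcomp Require Import all_boot all_order all_algebra.
From mathcomp Require Import complex.
From mathcomp Require Import all_classical all_reals all_analysis.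
Import Order.TTheory GRing.Theory Num.Theory.
Import numFieldNormedType.Exports.

Set Implicit Arguments.
Unset Strict Implicit.
Unset Printing Implicit Defensive.

Local Open Scope classical_set_scope.
Local Open Scope ring_scope.

Definition posdefmx (R : realType) (n : nat) (M : 'M[R]_n) : Prop :=
  forall x : 'cV[R]_n, x != 0 -> 0 < (x^T *m M *m x) 0 0.

(* [eigenvalue] is defined through row vectors ([v *m M = a *: v]); over a field
   the set of eigenvalues is the same as with column vectors. *)
Definition indefinite (R : realType) (n : nat) (M : 'M[R]_n) : Prop :=
  (exists2 a : R, eigenvalue M a & 0 < a) /\
  (exists2 a : R, eigenvalue M a & a < 0).

Definition toC (R : realType) (m n : nat) (M : 'M[R]_(m, n)) : 'M[R[i]]_(m, n) :=
  map_mx (real_complex R) M.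

(* The norm of [R[i]] takes its values in [R[i]]; [normc] is the modulus as a
   real number. The set is finite, and nonempty for 0 < n, so the supremum is a
   maximum. *)
Definition spectral_radius (R : realType) (n : nat) (M : 'M[R[i]]_n) : R :=
  sup [set ComplexField.Normc.normc z | z in [set z : R[i] | eigenvalue M z]].

(* Only used for a matrix whose complex eigenvalues are all real, so that
   ranging over the eigenvalues in R is ranging over the whole spectrum. *)
Definition max_abs_eigenvalue (R : realType) (n : nat) (M : 'M[R]_n) (xi : R) :
    Prop :=
  eigenvalue M xi /\ forall a : R, eigenvalue M a -> `|a| <= `|xi|.

(* [iunit] pins down the imaginary unit 0 +i* 1: the bare token 'i denotes
   another constant in ring_scope. *)
Definition iunit (R : realType) : R[i] := (0 +i* 1)%C.

Definition Gmx (R : realType) (n : nat) (W T : 'M[R]_n) (alpha : R) :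
    'M[R[i]]_n :=
  (1 / (alpha + 1))%:C%C *:
    ((iunit R * alpha%:C%C) *: toC (invmx T *m W) + 1%:M).

Definition plhss_seq (R : realType) (n : nat) (W T : 'M[R]_n) (alpha : R)
    (b : 'cV[R[i]]_n) (x : nat -> 'cV[R[i]]_n) : Prop :=
  forall k : nat,
    toC T *m x k.+1 =
      (1 / (alpha + 1))%:C%C *:
        (((iunit R * alpha%:C%C) *: toC W + toC T) *m x k)
      - ((alpha%:C%C * iunit R) / (alpha + 1)%:C%C) *: b.

(* Since T is nonsingular, [x] is determined by [x 0] and [b]; the cast on [s]
   selects the usual topology of R[i]^n, that of the modulus on each entry. *)
Definition plhss_convergent (R : realType) (n : nat) (W T : 'M[R]_n)
    (alpha : R) : Prop :=
  forall (b x0 : 'cV[R[i]]_n) (x : nat -> 'cV[R[i]]_n),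
    x 0%N = x0 -> plhss_seq W T alpha b x ->
    exists s : 'cV[R[i]]_n,
      unique (fun y : 'cV[R[i]]_n => (toC W + iunit R *: toC T) *m y = b) s /\
      x @ \oo --> (s : 'cV[(R[i] : numClosedFieldType)]_n).

(* Main.v *)
Require Import Defs.
From mathcomp Require Import all_boot all_order all_algebra.
From mathcomp Require Import complex.
From mathcomp Require Import all_classical all_reals all_analysis.
From mathcomp Require Import sesquilinear spectral ring lra.
Import Order.TTheory GRing.Theory Num.Theory.
Import numFieldNormedType.Exports.

Set Implicit Arguments.
Unset Strict Implicit.
Unset Printing Implicit Defensive.

Local Open Scope ring_scope.
Local Open Scope sesquilinear_scope.
Local Open Scope classical_set_scope.

(* Factoring W = Y^* Y with Y invertible shows that T^-1 W is similar to the
   Hermitian matrix Y T^-1 Y^*, hence to a real diagonal matrix diag(e). The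
   same change of basis turns G(W; alpha) into the diagonal matrix with entries
   (1 + i alpha e_j) / (alpha + 1), of modulus
   sqrt(alpha^2 e_j^2 + 1) / (alpha + 1), which increases with |e_j|. The error
   of the iteration is multiplied by G(W; alpha) at each step, so it tends to 0
   entrywise when all these moduli are < 1, and A = T (T^-1 W + i) is invertible
   because the e_j are real. *)

(** * Diagonalization of T^-1 W with real eigenvalues *)

(** The rows of [X] are left eigenvectors of [M]. Conversely, if v is a left eigenvector, then v
    X^-1 is one of the diagonal matrix, and any nonzero coordinate of it identifies the
    eigenvalue. *)
Lemma eigenvalue_diagonalized (F : fieldType) (n : nat) (X M : 'M[F]_n)
    (d : 'rV[F]_n) (z : F) :
  X \in unitmx -> X *m M = diag_mx d *m X ->
  eigenvalue M z <-> exists j, z = d 0 j.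
Proof.
move=> Xu XM; split=> [/eigenvalueP[v vM v0]|[j ->]].
  pose u := v *m invmx X.
  have uE : u *m diag_mx d = z *: u.
    rewrite /u -[diag_mx d](mulmxK Xu) -XM !mulmxA mulmxKV// vM.
    by rewrite -scalemxAl.
  have /rV0Pn[j uj] : u != 0.
    by apply: contraNneq v0 => u0; rewrite -(mulmxKV Xu v) -/u u0 mul0mx.
  exists j; move/matrixP/(_ 0 j): uE.
  rewrite mul_mx_diag mxE [RHS]mxE mulrC => dz.
  by apply: (mulIf uj); rewrite dz.
apply/eigenvalueP; exists (row j X).
  by rewrite -row_mul XM row_mul row_diag_mx -scalemxAl -rowE.
by rewrite rowE mul_mx_rowfree_eq0 ?row_free_unit//; apply/rV0Pn; exists j;
   rewrite mxE !eqxx oner_eq0.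
Qed.

Lemma toC_real (R : realType) (m n : nat) (M : 'M[R]_(m, n)) :
  toC M \is a realmx.
Proof.
by apply/mxOverP => i j; rewrite mxE; apply/complex_realP; exists (M i j).
Qed.

Lemma realmx_toC (R : realType) (m n : nat) (M : 'M[R[i]]_(m, n)) :
  M \is a realmx -> exists N, M = toC N.
Proof.
move=> /mxOverP Mr; exists (map_mx (@complex.Re R) M); apply/matrixP => i j.
by rewrite !mxE RRe_real.
Qed.

Lemma toC_trmxC (R : realType) (n : nat) (M : 'M[R]_n) :
  M^T = M -> (toC M)^t* = toC M.
Proof.
move=> Ms; rewrite -[in RHS]Ms; apply/matrixP => i j; rewrite !mxE.
by apply/CrealP/complex_realP; exists (M j i).
Qed.

Lemma hermitian_diagonalization (R : realType) (n : nat) (B : 'M[R[i]]_n) :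
  B^t* = B -> exists (P : 'M[R[i]]_n) (d : 'rV[R]_n),
    P \is unitarymx /\ P *m B = diag_mx (toC d) *m P.
Proof.
move=> BH; have Bh : B \is hermsymmx.
  by apply/is_hermitianmxP; rewrite expr0 scale1r BH.
have [d dE] := realmx_toC (hermitian_spectral_diag_real Bh).
exists (spectralmx B), d; split; first exact: spectral_unitarymx.
have /orthomx_spectralP {2}-> := hermitian_normalmx Bh.
by rewrite -dE !mulmxA mulmxV ?spectral_unit// mul1mx.
Qed.

(** For a left eigenvector v, v W v^T = a v v^T with v v^T >= 0, so a <= 0 would contradict
    positivity. *)
Lemma posdefmx_eigenvalue_gt0 (R : realType) (n : nat) (W : 'M[R]_n) (a : R) :
  posdefmx W -> eigenvalue W a -> 0 < a.
Proof.
move=> Wp /eigenvalueP[v vW v0].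
have vT0 : v^T != 0 by apply: contra_neq v0 => /(congr1 trmx); rewrite trmxK trmx0.
have := Wp _ vT0; rewrite trmxK vW -scalemxAl mxE.
have v2 : 0 <= (v *m v^T) 0 0.
  by rewrite mxE sumr_ge0// => i _; rewrite !mxE -expr2 sqr_ge0.
by rewrite ltNge; apply: contraTT; rewrite -leNgt => a0; rewrite mulr_le0_ge0.
Qed.

Lemma posdefmx_factorization (R : realType) (n : nat) (W : 'M[R]_n) :
  W^T = W -> posdefmx W ->
  exists2 Y : 'M[R[i]]_n, Y \in unitmx & toC W = Y^t* *m Y.
Proof.
move=> Ws Wp; have [P [d [Pu PW]]] := hermitian_diagonalization (toC_trmxC Ws).
have d_gt0 j : 0 < d 0 j.
  (* A real number is an eigenvalue of [W] as soon as it is one of [toC W]. *)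
  apply: (posdefmx_eigenvalue_gt0 Wp); rewrite -(eigenvalue_map (real_complex R)).
  apply/(eigenvalue_diagonalized _ (unitarymx_unit Pu) PW); exists j.
  by rewrite mxE.
pose s := map_mx Num.sqrt d.
have ss : diag_mx (toC s) *m diag_mx (toC s) = diag_mx (toC d).
  apply/matrixP => i j; rewrite mulmx_diag !mxE -rmorphM -expr2 sqr_sqrtr//.
  exact: ltW.
(* From W = P^* D P with P unitary, take Y = D^(1/2) P. *)
exists (diag_mx (toC s) *m P).
  rewrite unitmx_mul (unitarymx_unit Pu) andbT unitmxE det_diag unitfE.
  apply/prodf_neq0 => j _; rewrite !mxE.
  by rewrite (fmorph_eq0 (real_complex R)) sqrtr_eq0 -ltNge.
rewrite trmx_mul map_mxM tr_diag_mx map_diag_mx (realmxC (toC_real s)).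
rewrite -mulmxA (mulmxA (diag_mx _)) ss -PW mulmxA -invmx_unitary//.
by rewrite mulVmx ?mul1mx// unitarymx_unit.
Qed.

Lemma pencil_diagonalization (R : realType) (n : nat) (W T : 'M[R]_n) :
  W^T = W -> posdefmx W -> T^T = T ->
  exists (X : 'M[R[i]]_n) (e : 'rV[R]_n), X \in unitmx /\
    X *m toC (invmx T *m W) = diag_mx (toC e) *m X.
Proof.
move=> Ws Wp Ts; have [Y Yu WE] := posdefmx_factorization Ws Wp.
have [|Q [e [Qu QE]]] := @hermitian_diagonalization _ _ (Y *m toC (invmx T) *m Y^t*).
  rewrite !trmx_mul !map_mxM trmxCK toC_trmxC ?mulmxA//.
  by rewrite trmx_inv Ts.
exists (Q *m Y), e; split; first by rewrite unitmx_mul unitarymx_unit.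
by rewrite mulmxA -QE {1}/toC map_mxM -/(toC _) -/(toC W) WE !mulmxA.
Qed.

(** * Convergence of powers and of linear iterations *)

Lemma cvg_mx_coord (K : numFieldType) (m n : nat) (x : nat -> 'M[K]_(m, n))
    (s : 'M[K]_(m, n)) :
  (forall i j, (fun k => x k i j) @ \oo --> s i j) -> x @ \oo --> s.
Proof.
move=> xs; apply/cvg_ballP => eps eps0.
have : \forall k \near \oo, forall i j, ball (s i j) eps (x k i j).
  apply: filter_forall => i; apply: filter_forall => j.
  by move/cvg_ballP: (xs i j); apply.
by apply: filterS => k xk; split.
Qed.

(** A positive element of [R[i]] is real, so the claim reduces to the geometric limit in [R]. *)
Lemma complex_expr_small (R : realType) (z eps : R[i]) :
  ComplexField.Normc.normc z < 1 -> 0 < eps ->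
  \forall k \near \oo, `|z| ^+ k < eps.
Proof.
move=> z1 eps0; have /complex_realP[e eE] := gtr0_real eps0.
rewrite {}eE ltcR in eps0 *.
have z0 : 0 <= ComplexField.Normc.normc z by case: {z1}z => a b; exact: sqrtr_ge0.
have := @cvg_expr _ (ComplexField.Normc.normc z).
rewrite ger0_norm// => /(_ z1) /cvgrPdist_lt/(_ e eps0).
apply: filterS => k.
rewrite sub0r normrN ger0_norm ?exprn_ge0// => ze.
by rewrite -[`|z|]/((ComplexField.Normc.normc z)%:C)%C -rmorphXn ltcR.
Qed.

Lemma diagonalized_iter_cvg0 (K : numFieldType) (n : nat) (X M : 'M[K]_n)
    (d : 'rV[K]_n) (e : nat -> 'cV[K]_n) :
  X \in unitmx -> X *m M = diag_mx d *m X ->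
  (forall j eps, 0 < eps -> \forall k \near \oo, `|d 0 j| ^+ k < eps) ->
  (forall k, e k.+1 = M *m e k) ->
  e @ \oo --> (0 : 'cV[K]_n).
Proof.
move=> Xu XM d1 eS.
(* In the coordinates given by [X] the iteration decouples into scalar geometric sequences. *)
have Xe k j : (X *m e k) j 0 = d 0 j ^+ k * (X *m e 0%N) j 0.
  elim: k => [|k IH]; first by rewrite mul1r.
  by rewrite eS mulmxA XM -mulmxA mul_diag_mx mxE IH mulrA -exprS.
apply: cvg_mx_coord => i l; rewrite (ord1 l) mxE.
have eE : (fun k => e k i 0) =
    (fun k => \sum_j invmx X i j * (d 0 j ^+ k * (X *m e 0%N) j 0)).
  apply/funext => k; rewrite -{1}(mulKmx Xu (e k)) mxE.
  by apply: eq_bigr => j _; rewrite (Xe k).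
(* The limit 0 is written in the shape of the sum, so that each term can be treated separately. *)
rewrite eE -[X in _ --> X](_ : \sum_(j < n) 0 = 0); last by rewrite big1.
apply: cvg_big => [|j _].
  exact: add_continuous.
rewrite -[X in _ --> X](_ : invmx X i j * (0 * (X *m e 0%N) j 0) = 0); last first.
  by rewrite mul0r mulr0.
apply: cvgMl_tmp; apply: cvgMr_tmp; apply/cvgrPdist_lt => eps /(d1 j).
by apply: filterS => k; rewrite sub0r normrN normrX.
Qed.

(** * Eigenvalues and spectral radius of the iteration matrix *)

(** The eigenvalue of [Gmx W T alpha] that corresponds to the eigenvalue [e] of T^-1 W. *)
Definition G_eigenvalue (R : realType) (alpha e : R) : R[i] :=
  ((1 / (alpha + 1))%:C * (iunit R * alpha%:C * e%:C + 1))%C.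

Lemma normc_G_eigenvalue (R : realType) (alpha e : R) : 0 < alpha ->
  ComplexField.Normc.normc (G_eigenvalue alpha e) =
    1 / (alpha + 1) * Num.sqrt (alpha ^+ 2 * e ^+ 2 + 1).
Proof.
move=> a0; rewrite ComplexField.Normc.normcM /=; congr (_ * _).
  by rewrite expr0n addr0 sqrtr_sqr ger0_norm// divr_ge0// addr_ge0// ltW.
congr Num.sqrt; ring.
Qed.

(** G(W; alpha) is a polynomial of degree one in T^-1 W, so the same [X] diagonalizes both. *)
Lemma Gmx_diagonalized (R : realType) (n : nat) (W T : 'M[R]_n) (alpha : R)
    (X : 'M[R[i]]_n) (e : 'rV[R]_n) :
  X *m toC (invmx T *m W) = diag_mx (toC e) *m X ->
  X *m Gmx W T alpha = diag_mx (\row_j G_eigenvalue alpha (e 0 j)) *m X.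
Proof.
move=> XN; rewrite /Gmx -scalemxAr mulmxDr mulmx1 -scalemxAr XN.
apply/matrixP => i j; rewrite !mul_diag_mx !mxE /G_eigenvalue.
by rewrite !mulrDr mulrDl !mulrA mulr1.
Qed.

Lemma max_abs_eigenvalue_diagonalized (R : realType) (n : nat) (N : 'M[R]_n)
    (X : 'M[R[i]]_n) (e : 'rV[R]_n) (xi : R) :
  X \in unitmx -> X *m toC N = diag_mx (toC e) *m X ->
  max_abs_eigenvalue N xi ->
  (exists j, xi = e 0 j) /\ forall j, `|e 0 j| <= `|xi|.
Proof.
move=> Xu XN [xiN xi_max]; split=> [|j].
  move: xiN; rewrite -(eigenvalue_map (real_complex R)).
  move=> /(eigenvalue_diagonalized _ Xu XN)[j]; rewrite mxE => /complexI ->.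
  by exists j.
apply: xi_max; rewrite -(eigenvalue_map (real_complex R)).
by apply/(eigenvalue_diagonalized _ Xu XN); exists j; rewrite mxE.
Qed.

Lemma spectral_radius_diagonalized (R : realType) (n : nat) (M X : 'M[R[i]]_n)
    (d : 'rV[R[i]]_n) (j0 : 'I_n) :
  X \in unitmx -> X *m M = diag_mx d *m X ->
  (forall j, ComplexField.Normc.normc (d 0 j) <=
             ComplexField.Normc.normc (d 0 j0)) ->
  spectral_radius M = ComplexField.Normc.normc (d 0 j0).
Proof.
move=> Xu XM dmax; rewrite /spectral_radius.
set S := [set _ | _ in _].
have Sj0 : S (ComplexField.Normc.normc (d 0 j0)).
  by exists (d 0 j0) => //=; apply/(eigenvalue_diagonalized _ Xu XM); exists j0.
have Sub : ubound S (ComplexField.Normc.normc (d 0 j0)).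
  by move=> _ [z /= /(eigenvalue_diagonalized _ Xu XM)[j ->] <-].
apply/eqP; rewrite eq_le ge_sup ?ub_le_sup//.
- by exists (ComplexField.Normc.normc (d 0 j0)).
- by exists (ComplexField.Normc.normc (d 0 j0)).
Qed.

(** Squaring turns the claim into alpha^2 xi^2 + 1 < (alpha + 1)^2, which is the hypothesis
    multiplied by alpha. *)
Lemma sqrt_lt_affine (R : realType) (alpha xi : R) : 0 < alpha ->
  alpha * (xi ^+ 2 - 1) < 2 ->
  1 / (alpha + 1) * Num.sqrt (alpha ^+ 2 * xi ^+ 2 + 1) < 1.
Proof.
move=> a0 axi; have a1 : 0 < alpha + 1 by lra.
rewrite mulrC mulrA mulr1 ltr_pdivrMr// mul1r.
rewrite -[ltRHS]ger0_norm ?(ltW a1)// -sqrtr_sqr ltr_sqrt ?exprn_gt0//.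
by nra.
Qed.

(** * Solvability of the system and convergence of the iteration *)

(** The matrix factors as T X^-1 diag(e_j + i) X, and each e_j + i has imaginary part 1, hence is
    nonzero. *)
Lemma plhss_system_unit (R : realType) (n : nat) (W T : 'M[R]_n)
    (X : 'M[R[i]]_n) (e : 'rV[R]_n) :
  T \in unitmx -> X \in unitmx ->
  X *m toC (invmx T *m W) = diag_mx (toC e) *m X ->
  toC W + iunit R *: toC T \in unitmx.
Proof.
move=> Tu Xu XN.
have TC : toC T \in unitmx by rewrite map_unitmx.
have WN : toC W = toC T *m toC (invmx T *m W) by rewrite -map_mxM mulKVmx.
rewrite (_ : _ + _ =
    toC T *m (invmx X *m diag_mx (\row_j ((e 0 j)%:C%C + iunit R)) *m X)).
  rewrite !unitmx_mul TC Xu unitmx_inv Xu andbT /= unitmxE det_diag unitfE.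
  apply/prodf_neq0 => j _; rewrite mxE eq_complex /= negb_and.
  by rewrite add0r oner_eq0 orbT.
rewrite WN -mulmxA.
rewrite (_ : diag_mx _ = diag_mx (toC e) + (iunit R)%:M).
  rewrite mulmxDl -XN mulmxDr mulKmx// mul_scalar_mx -scalemxAr mulVmx//.
  by rewrite mulmxDr -scalemxAr mulmx1.
by apply/matrixP => i j; rewrite !mxE mulrnDl.
Qed.

Lemma plhss_convergent_diagonalized (R : realType) (n : nat) (W T : 'M[R]_n)
    (alpha : R) (X : 'M[R[i]]_n) (e : 'rV[R]_n) :
  T \in unitmx -> X \in unitmx -> 0 < alpha ->
  X *m toC (invmx T *m W) = diag_mx (toC e) *m X ->
  (forall j, ComplexField.Normc.normc (G_eigenvalue alpha (e 0 j)) < 1) ->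
  plhss_convergent W T alpha.
Proof.
move=> Tu Xu a0 XN g1 b x0 x _ xS.
have TC : toC T \in unitmx by rewrite map_unitmx.
have WN : toC W = toC T *m toC (invmx T *m W) by rewrite -map_mxM mulKVmx.
have Au := plhss_system_unit Tu Xu XN.
set A := toC W + _ in Au *.
pose s := invmx A *m b.
have As : A *m s = b by rewrite mulKVmx.
have a1 : (alpha + 1)%:C%C != 0 :> R[i].
  by rewrite (fmorph_eq0 (real_complex R)) gt_eqF// addr_gt0.
(* The exact solution is a fixed point of the iteration. *)
have sS : toC T *m s = (1 / (alpha + 1))%:C%C *:
        (((iunit R * alpha%:C%C) *: toC W + toC T) *m s)
      - ((alpha%:C%C * iunit R) / (alpha + 1)%:C%C) *: b.
  rewrite -As /A !mulmxDl -!scalemxAl.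
  move: (toC W *m s) (toC T *m s) => w t.
  apply/matrixP => i j; rewrite !mxE.
  have ii : iunit R * iunit R = -1 by rewrite -expr2 sqr_i.
  rewrite rmorphM rmorph1 fmorphV rmorphD rmorph1 in a1 *.
  (* The terms in [w] cancel. Keeping i^2 + 1 as a factor gives an identity that [field] proves with
     i as an indeterminate. *)
  transitivity (t i j - alpha%:C%C * t i j * (iunit R * iunit R + 1) /
     (alpha%:C%C + 1)); last by field.
  by rewrite ii addNr mulr0 mul0r subr0.
exists s; split.
  split => // y Ay; by rewrite /s -Ay mulKmx.
pose er k := x k - s.
have erS k : er k.+1 = Gmx W T alpha *m er k.
  (* Subtracting the fixed-point equation eliminates [b]. *)
  have TerS : toC T *m er k.+1 = (1 / (alpha + 1))%:C%C *:
      (((iunit R * alpha%:C%C) *: toC W + toC T) *m er k).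
    by rewrite /er !mulmxBr xS sS opprB addrA addrNK -scalerBr.
  rewrite -[LHS](mulKmx TC) TerS -scalemxAr mulmxA (mulmxDr (invmx _)).
  rewrite -scalemxAr WN.
  by rewrite mulKmx// mulVmx// scalemxAl.
have er0 : er @ \oo --> (0 : 'cV[(R[i] : numClosedFieldType)]_n).
  apply: (diagonalized_iter_cvg0 Xu (Gmx_diagonalized alpha XN) _ erS).
  by move=> j eps; rewrite mxE; exact: complex_expr_small.
rewrite (_ : x = (fun k => er k + s)); last by apply/funext => k; rewrite subrK.
rewrite -[X in _ --> X]add0r; apply: (cvgD er0); exact: cvg_cst.
Qed.

(** * Spectral radius formula and the two cases *)

Theorem theorem3p3 (R : realType) (n : nat) (W T : 'M[R]_n) (xi : R)
    (W_sym : W^T = W) (W_posdef : posdefmx W)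
    (T_sym : T^T = T) (T_indef : indefinite T) (T_nonsing : T \in unitmx)
    (xi_max : max_abs_eigenvalue (invmx T *m W) xi) :
  (forall alpha : R, 0 < alpha ->
     spectral_radius (Gmx W T alpha) =
       1 / (alpha + 1) * Num.sqrt (alpha ^+ 2 * xi ^+ 2 + 1)) /\
  (`|xi| <= 1 -> forall alpha : R, 0 < alpha ->
     spectral_radius (Gmx W T alpha) < 1 /\ plhss_convergent W T alpha) /\
  (1 < `|xi| -> forall alpha : R, 0 < alpha -> alpha < 2 / (xi ^+ 2 - 1) ->
     spectral_radius (Gmx W T alpha) < 1).
Proof.
have [X [e [Xu XN]]] := pencil_diagonalization W_sym W_posdef T_sym.
have [[j0 xiE] e_le] := max_abs_eigenvalue_diagonalized Xu XN xi_max.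
have g_le alpha j : 0 < alpha ->
    ComplexField.Normc.normc (G_eigenvalue alpha (e 0 j)) <=
    ComplexField.Normc.normc (G_eigenvalue alpha xi).
  move=> a0; rewrite !normc_G_eigenvalue// ler_wpM2l//.
    by rewrite divr_ge0// addr_ge0// ltW.
  rewrite ler_wsqrtr// lerD2r ler_wpM2l ?sqr_ge0//.
  by rewrite -[leLHS]real_normK ?num_real// -[leRHS]real_normK ?num_real//
    ler_sqr ?nnegrE.
have rho alpha : 0 < alpha ->
    spectral_radius (Gmx W T alpha) =
    ComplexField.Normc.normc (G_eigenvalue alpha xi).
  move=> a0; have := @spectral_radius_diagonalized _ _ _ _ _ j0 Xu
    (Gmx_diagonalized alpha XN).
  rewrite mxE -xiE; apply => j; rewrite mxE; exact: g_le.
split; last split.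
- by move=> alpha a0; rewrite rho// normc_G_eigenvalue.
- move=> xi1 alpha a0.
  have xi2 : xi ^+ 2 <= 1 by rewrite -[leLHS]real_normK ?num_real// expr_le1.
  have G1 : ComplexField.Normc.normc (G_eigenvalue alpha xi) < 1.
    (* Here alpha (xi^2 - 1) <= 0 < 2. *)
    by rewrite normc_G_eigenvalue//; apply: sqrt_lt_affine => //; nra.
  rewrite rho//; split=> //.
  apply: (plhss_convergent_diagonalized T_nonsing Xu a0 XN) => j.
  exact: le_lt_trans (g_le _ _ a0) G1.
- move=> xi1 alpha a0 axi; rewrite rho// normc_G_eigenvalue//.
  (* Since xi^2 - 1 > 0, the bound on [alpha] can be multiplied by it. *)
  apply: sqrt_lt_affine => //; rewrite -ltr_pdivlMr//.
  by rewrite subr_gt0 -[ltRHS]real_normK ?num_real// expr_gt1.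
Qed.
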